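(* The set of positive integers $n$ that are $s$-practical and satisfy $n^{1/2}\le S_s(n)$ has asymptotic density $0$.
   Context: $s(n)=\sigma(n)-n$ is the sum of proper divisors of $n$, and $S_s(n)=\sum_{d\mid n}s(d)$. A positive integer $n$ is $s$-practical if every positive integer $m\le S_s(n)$ equals $\sum_{d\in\mathcal{D}}s(d)$ for some set $\mathcal{D}$ of distinct positive divisors of $n$. *)

(* Defs.v *)
From mathcomp Require Import all_boot all_order all_algebra.
From mathcomp Require Import boolp.
Set Implicit Arguments. Unset Strict Implicit. Unset Printing Implicit Defensive.
Import Order.TTheory GRing.Theory Num.Theory.

Definition sigma (n : nat) : nat := \sum_(d <- divisors n) d.

Definition s (n : nat) : nat := sigma n - n.

Definition S_s (n : nat) : nat := \sum_(d <- divisors n) s d.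

(* n is s-practical: every positive m <= S_s(n) is a sum of s(d) over a set
   of distinct positive divisors d of n (a subsequence of the sorted,
   duplicate-free list of divisors of n). *)
Definition s_practical (n : nat) : Prop :=
  forall m : nat, 0 < m -> m <= S_s n ->
    exists D : seq nat, subseq D (divisors n) /\ m = \sum_(d <- D) s d.

Definition count_upto (P : nat -> Prop) (x : nat) : nat :=
  #|[set n : 'I_x.+1 | (0 < (n : nat)) && `[< P n >]]|.

Definition density_zero (P : nat -> Prop) : Prop :=
  forall eps : rat, (0 < eps)%R ->
    exists N : nat, forall x : nat, (N <= x)%N ->
      ((count_upto P x)%:R <= eps * x%:R)%R.

(* Main.v *)
Require Import Defs.
From mathcomp Require Import all_boot all_order all_algebra.
From mathcomp Require Import boolp.
From mathcomp Require Import ring lra zify.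
Import Order.TTheory GRing.Theory Num.Theory.

(** Counting sets of divisors, an [s]-practical [n] has [S_s n < 2 ^ tau n], so
    [n <= S_s n ^ 2] forces [tau n >= c * log n].  The mean of [tau] is [log n],
    so plain Markov does not suffice.  Fix a finite set [P] of large primes and
    discard the few [n] divisible by the square of one of them.  With
    [w n = (10/7) ^ #{p in P : p | n}] and [t n] the number of divisors of [n]
    prime to [P], we have [tau n = 2 ^ #{p in P : p | n} * t n <= w n ^ 2 * t n],
    so [w n >= K] or [w n * t n >= c * log n / K].  The mean of [w] is at most
    [A = \prod_(p in P) (1 + (3/7)/p)], and that of [w * t] is at most
    [A * \sum_(e <= x, e prime to P) 1/e <= (A / B) * (log x + O(1))] with
    [B = \prod_(p in P) (1 + 1/p)].  Taking [K = A / eps], both cases are rare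
    as soon as [A ^ 2 / B] is small, which the divergence of
    [\prod_p (1 + 1/p)] allows because [2 * (3/7) < 1]. *)

Set Implicit Arguments.
Unset Strict Implicit.
Local Open Scope ring_scope.

(** * Divisor weights attached to a finite set of primes, and their mean *)

Definition no_dvd (P : seq nat) (e : nat) : bool :=
  all (fun p => ~~ (p %| e)%N) P.

Definition harmonic (P : seq nat) (N : nat) : rat :=
  \sum_(1 <= e < N.+1 | no_dvd P e) e%:R^-1.

(* The constant 3/7 is chosen so that (1 + 3/7)^2 >= 2 and 2 * (3/7) < 1. *)
Definition weight (P : seq nat) (n : nat) : rat :=
  \prod_(p <- P) (1 + 3 / 7 * (p %| n)%N%:R).

Definition ndiv (P : seq nat) (n : nat) : nat := count (no_dvd P) (divisors n).

Lemma no_dvd_mul (p : nat) (P : seq nat) (e : nat) :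
  prime p -> all prime P -> p \notin P ->
  no_dvd P (p * e) = no_dvd P e.
Proof.
move=> p_pr P_pr pNP; apply: eq_in_all => q qP.
have q_pr := allP P_pr q qP.
rewrite Euclid_dvdM // dvdn_prime2 //.
by case: eqP => // eq_qp; rewrite -eq_qp qP in pNP.
Qed.

Lemma sum_dvdn_le (e x : nat) :
  \sum_(1 <= n < x.+1) (e %| n)%N%:R <= x%:R / e%:R :> rat.
Proof.
rewrite -natr_sum -divn_count_dvd.
case: e => [|e]; first by rewrite divn0 invr0 mulr0.
by rewrite ler_pdivlMr ?ltr0n // -natrM ler_nat leq_divM.
Qed.

Lemma weight_ge1 (P : seq nat) (n : nat) : 1 <= weight P n.
Proof.
elim: P => [|p P IH]; rewrite /weight ?big_nil // big_cons -/(weight P n).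
by case: (p %| n)%N => /=; lra.
Qed.

(** Expanding the factor at [p] splits the sum into one over multiples of [e] and [3 / 7] times one
    over multiples of [p * e], as [p] and [e] are coprime. The induction on [P] therefore needs [e]
    to be arbitrary. *)
Lemma sum_weight_dvd_le (P : seq nat) (e x : nat) :
  all prime P -> uniq P -> no_dvd P e ->
  \sum_(1 <= n < x.+1) (e %| n)%N%:R * weight P n
    <= x%:R / e%:R * \prod_(p <- P) (1 + 3 / 7 / p%:R).
Proof.
elim: P e => [|p P IH] e /=.
  move=> _ _ _; rewrite big_nil mulr1; apply: le_trans (sum_dvdn_le e x).
  by apply: ler_sum => n _; rewrite /weight big_nil mulr1.
move=> /andP[p_pr P_pr] /andP[pNP P_uniq] /andP[pNe eP].
rewrite big_cons.
have co_pe : coprime p e by rewrite prime_coprime.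
have IHe := IH e P_pr P_uniq eP.
have := IH (p * e)%N P_pr P_uniq; rewrite no_dvd_mul // => /(_ eP) IHpe.
have -> : \sum_(1 <= n < x.+1) (e %| n)%N%:R * weight (p :: P) n =
  \sum_(1 <= n < x.+1) (e %| n)%N%:R * weight P n +
  3 / 7 * \sum_(1 <= n < x.+1) (p * e %| n)%N%:R * weight P n.
  rewrite big_distrr -big_split /=; apply: eq_bigr => n _.
  rewrite Gauss_dvd // /weight big_cons.
  by case: (p %| n)%N; case: (e %| n)%N => /=; ring.
rewrite natrM invfM in IHpe.
set A := \prod_(p <- P) _ in IHe IHpe *.
have -> : x%:R / e%:R * ((1 + 3 / 7 / p%:R) * A) =
  x%:R / e%:R * A + 3 / 7 * (x%:R * (p%:R^-1 / e%:R) * A) by ring.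
lra.
Qed.

(** * Harmonic sums when one more prime is excluded *)

Lemma sum_multiples (p N : nat) (F : nat -> rat) : (0 < p)%N ->
  \sum_(1 <= e < (p * N).+1 | (p %| e)%N) F e = \sum_(1 <= f < N.+1) F (p * f)%N.
Proof.
move=> p_gt0; elim: N => [|N IH]; first by rewrite muln0 !big_geq.
rewrite big_nat_recr //= -IH (big_cat_nat (n := (p * N).+1)) //=; last first.
  by rewrite ltnS leq_mul2l leqnSn orbT.
congr (_ + _).
(* In the block from [p * N + 1] to [p * N.+1] only the last index is a multiple of [p]. *)
have -> : (p * N.+1).+1 = ((p * N) + p.-1).+2 by rewrite mulnS; lia.
rewrite big_mkcond big_nat_recr /=; last by lia.
have eqE : ((p * N) + p.-1).+1 = (p * N.+1)%N by rewrite mulnS; lia.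
rewrite eqE dvdn_mulr // big_nat_cond big1 ?add0r // => i.
rewrite andbT => /andP[lo hi].
case: ifP => // /dvdnP[k Ek]; exfalso; move: lo hi; rewrite Ek (mulnC k).
by rewrite ltn_mul2l => /andP[_ ?]; rewrite ltn_mul2l => /andP[_ ?]; lia.
Qed.

(** The integers [f <= N] prime to [p :: P] and their multiples [p * f] are disjoint families of
    integers prime to [P], all at most [p * N]. *)
Lemma harmonic_cons_mul_le (p : nat) (P : seq nat) (N : nat) :
  prime p -> all prime P -> p \notin P ->
  (1 + p%:R^-1) * harmonic (p :: P) N <= harmonic P (p * N).
Proof.
move=> p_pr P_pr pNP; have p_gt0 := prime_gt0 p_pr.
rewrite /harmonic [leRHS](bigID (fun e => p %| e)%N) /= mulrDl mul1r addrC.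
apply: lerD.
  rewrite [leRHS](big_cat_nat (n := N.+1)) //=; last by rewrite ltnS leq_pmull.
  rewrite -[leLHS]addr0; apply: lerD.
    by under eq_bigl do rewrite andbC.
  by apply: sumr_ge0 => e _; rewrite invr_ge0 ler0n.
under [leRHS]eq_bigl do rewrite andbC.
rewrite [leRHS]big_mkcondr /= sum_multiples // big_distrr [leLHS]big_mkcond /=.
apply: ler_sum => f _; rewrite no_dvd_mul // natrM invfM.
by case: (p %| f)%N; case: (no_dvd P f) => //=; rewrite mulr_ge0 // invr_ge0 ler0n.
Qed.

(** The terms lost by excluding [p] are the [e = p * f] with [f] prime to [P], of total at most
    [harmonic P N / p]. *)
Lemma harmonic_le_cons (p : nat) (P : seq nat) (N : nat) : prime p ->
  (1 - p%:R^-1) * harmonic P N <= harmonic (p :: P) N.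
Proof.
move=> p_pr; have p_gt0 := prime_gt0 p_pr.
suff : harmonic P N <= harmonic (p :: P) N + p%:R^-1 * harmonic P N by lra.
rewrite {1}/harmonic (bigID (fun e => p %| e)%N) /= addrC; apply: lerD.
  by under eq_bigl do rewrite andbC.
under eq_bigl do rewrite andbC.
have ge0 e : 0 <= (if no_dvd P e then e%:R^-1 else 0) :> rat.
  by case: ifP; rewrite // invr_ge0 ler0n.
rewrite big_mkcondr /=.
(* The range is enlarged to [p * N] so that [f] runs exactly up to [N]. *)
apply: (@le_trans _ _ (\sum_(1 <= e < (p * N).+1 | (p %| e)%N)
   (if no_dvd P e then e%:R^-1 else 0))).
  rewrite [leRHS](big_cat_nat (n := N.+1)) //=; last by rewrite ltnS leq_pmull.
  by rewrite lerDl sumr_ge0.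
rewrite sum_multiples // /harmonic big_distrr [leRHS]big_mkcond /=.
apply: ler_sum => f _; rewrite natrM invfM.
have : no_dvd P (p * f) -> no_dvd P f.
  by move=> /allP h; apply/allP => q /h; apply: contra; apply: dvdn_mull.
case: (no_dvd P f); case: (no_dvd P (p * f)) => //.
- by rewrite mulr_ge0 // invr_ge0 ler0n.
- by move=> /(_ isT).
Qed.

(** * Divisors prime to the chosen primes *)

(** When [p] divides [n] exactly once, [d |-> d / p] injects the divisors counted by [ndiv P n] that
    are multiples of [p] into those counted by [ndiv (p :: P) n]. *)
Lemma ndiv_le_cons (p : nat) (P : seq nat) (n : nat) :
  prime p -> (0 < n)%N -> ~~ (p ^ 2 %| n)%N ->
  (ndiv P n <= (1 + (p %| n)) * ndiv (p :: P) n)%N.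
Proof.
move=> p_pr n_gt0 p2Nn; have p_gt0 := prime_gt0 p_pr.
rewrite /ndiv -sum1_count (bigID (fun e => p %| e)%N) /= mulnDl mul1n addnC.
apply: leq_add.
  rewrite sum1_count leq_eqVlt; apply/orP/or_introl/eqP/eq_count => e.
  by rewrite /= andbC.
case: (boolP (p %| n)%N) => [pn|pNn]; last first.
  rewrite mul0n leqn0 big_seq_cond big1 // => d.
  rewrite -dvdn_divisors // => /andP[dn /andP[_ pd]].
  by rewrite (dvdn_trans pd dn) in pNn.
rewrite mul1n sum1_count -!size_filter -(size_map (divn^~ p)).
apply: uniq_leq_size.
  rewrite map_inj_in_uniq ?filter_uniq ?divisors_uniq // => d1 d2.
  rewrite !mem_filter => /andP[/andP[_ pd1] _] /andP[/andP[_ pd2] _] E.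
  by rewrite -(divnK pd1) E divnK.
move=> _ /mapP[d + ->]; rewrite !mem_filter -!dvdn_divisors //.
move=> /andP[/andP[dP /dvdnP[k Ek]] dn]; rewrite {}Ek in dP dn *.
rewrite mulnK // (dvdn_trans _ dn) ?dvdn_mulr // andbT /=.
apply/andP; split.
  apply: contra p2Nn => pk; apply: dvdn_trans dn.
  by rewrite expnS expn1 dvdn_mul.
by apply/allP => q /(allP dP); apply: contra; apply: dvdn_mulr.
Qed.

Lemma size_divisors_le_weight (P : seq nat) (n : nat) :
  all prime P -> (0 < n)%N -> all (fun p => ~~ (p ^ 2 %| n)%N) P ->
  (size (divisors n))%:R <= weight P n ^+ 2 * (ndiv P n)%:R.
Proof.
move=> + n_gt0; elim: P => [|p P IH] /=.
  by rewrite /weight big_nil expr1n mul1r /ndiv count_predT.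
move=> /andP[p_pr P_pr] /andP[pn Pn]; apply: le_trans (IH P_pr Pn) _.
have := ndiv_le_cons P p_pr n_gt0 pn; rewrite -(ler_nat rat) natrM natrD.
set u := (ndiv P n)%:R; set v := (ndiv _ n)%:R => le_uv.
have v_ge0 : 0 <= v by rewrite /v ler0n.
rewrite /weight big_cons -/(weight P n) exprMn [X in X * v]mulrC -[leRHS]mulrA.
apply: ler_wpM2l; first by rewrite sqr_ge0.
apply: le_trans le_uv _; apply: ler_wpM2r => //.
by case: (p %| n)%N => /=; lra.
Qed.

(** Writing [ndiv P n] as a sum over [e] and exchanging the sums leaves, for each [e] prime to [P],
    the sum bounded in [sum_weight_dvd_le]. *)
Lemma sum_weight_ndiv_le (P : seq nat) (x : nat) :
  all prime P -> uniq P ->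
  \sum_(1 <= n < x.+1) weight P n * (ndiv P n)%:R
    <= x%:R * \prod_(p <- P) (1 + 3 / 7 / p%:R) * harmonic P x.
Proof.
move=> P_pr P_uniq.
have ndivE n : (0 < n < x.+1)%N ->
    (ndiv P n)%:R = \sum_(1 <= e < x.+1 | no_dvd P e) (e %| n)%N%:R :> rat.
  move=> /andP[n_gt0 le_nx]; rewrite -natr_sum /ndiv -size_filter; congr _%:R.
  rewrite big_mkcond /=.
  have -> : (\sum_(1 <= e < x.+1) (if no_dvd P e then nat_of_bool (e %| n)%N else 0) =
    \sum_(1 <= e < x.+1 | no_dvd P e && (e %| n)%N) 1)%N.
    by rewrite [RHS]big_mkcond; apply: eq_bigr => e _; do 2!case: ifP => //=.
  rewrite -big_filter sum1_size; apply/perm_size/uniq_perm.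
  - by rewrite filter_uniq ?divisors_uniq.
  - by rewrite filter_uniq ?iota_uniq.
  move=> e; rewrite !mem_filter mem_index_iota -dvdn_divisors // -andbA.
  case: (no_dvd P e) => //=; case: (boolP (e %| n)%N) => //= en.
  by rewrite (dvdn_gt0 n_gt0 en) (leq_ltn_trans (dvdn_leq n_gt0 en) le_nx).
rewrite (_ : \sum_(1 <= n < x.+1) _ = \sum_(1 <= e < x.+1 | no_dvd P e)
    \sum_(1 <= n < x.+1) (e %| n)%N%:R * weight P n); last first.
  rewrite exchange_big /=; apply: eq_big_nat => n /ndivE ->.
  by rewrite mulrC mulr_suml.
rewrite /harmonic mulr_sumr; apply: ler_sum => e eP.
rewrite mulrAC; exact: sum_weight_dvd_le.
Qed.

(** * Euler products against harmonic sums *)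

(** Excluding the primes of [P] saves the full factor [\prod (1 + 1/p)]. The price is a longer
    range, which for fixed [P] adds only a constant to the logarithm. *)
Lemma prod_mul_harmonic_le (P : seq nat) (N : nat) :
  all prime P -> uniq P ->
  \prod_(p <- P) (1 + p%:R^-1) * harmonic P N
    <= harmonic [::] (\prod_(p <- P) p * N).
Proof.
elim: P N => [|p P IH] N /=; first by rewrite !big_nil mul1r mul1n.
move=> /andP[p_pr P_pr] /andP[pNP P_uniq]; rewrite !big_cons.
rewrite -mulnA mulnCA; apply: le_trans (IH _ P_pr P_uniq).
rewrite -mulrA mulrCA; apply: ler_wpM2l; last exact: harmonic_cons_mul_le.
by apply: prodr_ge0 => q _; rewrite addr_ge0 // invr_ge0 ler0n.
Qed.

Lemma prod_mul_harmonic_ge (P : seq nat) (N : nat) : all prime P ->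
  \prod_(p <- P) (1 - p%:R^-1) * harmonic [::] N <= harmonic P N.
Proof.
elim: P => [|p P IH] /=; first by rewrite !big_nil mul1r.
move=> /andP[p_pr P_pr]; rewrite !big_cons -mulrA.
apply: le_trans (harmonic_le_cons P N p_pr); apply: ler_wpM2l (IH P_pr).
by rewrite subr_ge0 invf_le1 ?ltr0n ?ler1n prime_gt0.
Qed.

(** The block has [2 ^ k] terms, each between [2 ^ -(k+1)] and [2 ^ -k]. *)
Lemma dyadic_block_bounds (k : nat) :
  1 / 2 <= \sum_(2 ^ k <= e < 2 ^ k.+1) (e%:R^-1 : rat) <= 1.
Proof.
have pw_gt0 : 0 < (2 ^ k)%N%:R :> rat by rewrite ltr0n expn_gt0.
have cE : \sum_(2 ^ k <= e < 2 ^ k.+1) (2 ^ k)%N%:R^-1 = 1 :> rat.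
  rewrite sumr_const_nat expnS mul2n -addnn addnK -[_ *+ _]mulr_natl.
  by rewrite mulfV // gt_eqF.
have cE2 : \sum_(2 ^ k <= e < 2 ^ k.+1) ((2 ^ k)%N%:R^-1 / 2) = 1 / 2 :> rat.
  by rewrite -mulr_suml cE.
apply/andP; split; [rewrite -cE2 | rewrite -[leRHS]cE];
  rewrite big_nat_cond [leRHS]big_nat_cond; apply: ler_sum => e;
  rewrite andbT => /andP[lo hi].
  rewrite -invfM -natrM lef_pV2 ?posrE ?ltr0n ?muln_gt0 ?expn_gt0 //; last first.
    by apply: leq_trans lo; rewrite expn_gt0.
  by rewrite ler_nat mulnC -expnS ltnW.
rewrite lef_pV2 ?posrE ?ltr0n ?ler_nat ?expn_gt0 //.
by apply: leq_trans lo; rewrite expn_gt0.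
Qed.

Lemma dyadic_harmonic_bounds (k : nat) :
  k%:R / 2 <= \sum_(1 <= e < 2 ^ k) (e%:R^-1 : rat) <= k%:R.
Proof.
elim: k => [|k IH]; first by rewrite big_geq // mul0r lexx.
rewrite (big_cat_nat (n := 2 ^ k)%N) ?expn_gt0 //=; last first.
  by rewrite leq_exp2l.
have /andP[? ?] := dyadic_block_bounds k; case/andP: IH => ? ?.
by rewrite -natr1; apply/andP; split; lra.
Qed.

Lemma harmonic_le (N k : nat) : (N < 2 ^ k)%N -> harmonic [::] N <= k%:R.
Proof.
move=> ltN; have /andP[_] := dyadic_harmonic_bounds k; apply: le_trans.
rewrite /harmonic [leRHS](big_cat_nat (n := N.+1)) //= lerDl.
by apply: sumr_ge0 => e _; rewrite invr_ge0 ler0n.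
Qed.

Lemma harmonic_unbounded (C : rat) : exists N : nat, C <= harmonic [::] N.
Proof.
have [k Ck] : exists k : nat, 2 * C <= k%:R.
  exists (Num.bound `|2 * C|).
  exact: le_trans (ler_norm _) (ltW (archi_boundP (normr_ge0 _))).
exists (2 ^ k).-1; have /andP[h _] := dyadic_harmonic_bounds k.
rewrite /harmonic prednK ?expn_gt0 //; lra.
Qed.

(** * Divergence of products over primes *)

Definition primes_in (a b : nat) : seq nat :=
  [seq p <- index_iota a b | prime p].

Lemma all_prime_primes_in (a b : nat) : all prime (primes_in a b).
Proof. exact: filter_all. Qed.

Lemma uniq_primes_in (a b : nat) : uniq (primes_in a b).
Proof. by rewrite filter_uniq ?iota_uniq. Qed.

(** Only [e = 1] survives: any other [e <= N] has a prime factor at most [N]. *)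
Lemma harmonic_primes_in (N : nat) : harmonic (primes_in 0 N.+1) N <= 1.
Proof.
rewrite /harmonic; case: N => [|N]; first by rewrite big_geq.
rewrite big_mkcond big_nat_recl // big_nat_cond big1 /=.
  by rewrite addr0; case: ifP => // _; rewrite invr1.
move=> i; rewrite andbT => /andP[i_gt0 lt_i]; case: ifP => // /allP h.
have := h (pdiv i.+1); rewrite mem_filter pdiv_prime //= pdiv_dvd.
rewrite mem_index_iota /= => h'; exfalso; move: h' => /(_ _)/negP; apply => //.
by apply: leq_ltn_trans (dvdn_leq _ (pdiv_dvd _)) _.
Qed.

(** Euler's argument: over the primes up to [N], [\prod (1 - 1/p)] times the harmonic sum is at most
    1, and the 28th power of the product of the [1 + 1/(14p)] dominates the inverse of
    [\prod (1 - 1/p)]. *)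
Lemma prod_primes_unbounded (a : nat) (C : rat) : 0 <= C ->
  exists b : nat, C <= \prod_(p <- primes_in a b) (1 + 1 / 14 / p%:R).
Proof.
move=> C_ge0.
have ge1 (p : nat) : 1 <= 1 + 1 / 14 / p%:R :> rat.
  by rewrite lerDl mulr_ge0 // invr_ge0 ler0n.
have prod_gt0 (P : seq nat) : 0 < \prod_(p <- P) (1 + 1 / 14 / p%:R) :> rat.
  by apply: prodr_gt0 => p _; apply: lt_le_trans (ge1 p).
(* The primes below [a] contribute the fixed factor [c], so the product over all primes has to reach
   [c * C]. *)
set c := \prod_(p <- primes_in 0 a) (1 + 1 / 14 / p%:R) : rat.
have c_gt0 : 0 < c by exact: prod_gt0.
have [N hN] := harmonic_unbounded ((c * C) ^+ 28).
exists (maxn a N.+1).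
suff : c * C <= \prod_(p <- primes_in 0 (maxn a N.+1)) (1 + 1 / 14 / p%:R).
  rewrite /primes_in big_filter (big_cat_nat (n := a)) ?leq_maxl //=.
  by rewrite -!(big_filter _ prime) -/(primes_in _ _) ler_pM2l.
apply: (@le_trans _ _ (\prod_(p <- primes_in 0 N.+1) (1 + 1 / 14 / p%:R))); last first.
  rewrite /primes_in !big_filter [leRHS](big_cat_nat (n := N.+1)) ?leq_maxr //=.
  rewrite ler_peMr //; first by rewrite -big_filter ltW ?prod_gt0.
  by apply: (big_ind (fun x : rat => 1 <= x)) => // x y x1 y1; rewrite mulr_ege1.
rewrite -(@ler_pXn2r _ 28) ?nnegrE ?mulr_ge0 ?(ltW c_gt0) ?(ltW (prod_gt0 _)) //.
apply: le_trans hN _.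
set P := primes_in 0 N.+1.
have P_pr : all prime P by exact: all_prime_primes_in.
have h : \prod_(p <- P) (1 - p%:R^-1) * harmonic [::] N <= 1.
  exact: le_trans (prod_mul_harmonic_ge N P_pr) (harmonic_primes_in N).
have H_ge0 : 0 <= harmonic [::] N by apply: sumr_ge0 => e _; rewrite invr_ge0 ler0n.
suff step : 1 <= \prod_(p <- P) (1 - p%:R^-1) *
    (\prod_(p <- P) (1 + 1 / 14 / p%:R)) ^+ 28 :> rat.
  have X_ge0 : 0 <= (\prod_(p <- P) (1 + 1 / 14 / p%:R)) ^+ 28 :> rat.
    by rewrite exprn_ge0 // ltW.
  apply: le_trans (ler_peMl H_ge0 step) _.
  by rewrite mulrAC -[leRHS]mul1r; apply: ler_wpM2r.
rewrite -prodrXl -big_split big_seq /=.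
apply: (big_ind (fun x : rat => 1 <= x)) => // [x y x1 y1|p pP].
  by rewrite mulr_ege1.
have p_gt1 := prime_gt1 (allP P_pr p pP).
(* Bernoulli: (1 + 1/(14p))^28 >= 1 + 2/p >= 1/(1 - 1/p) *)
set t : rat := p%:R^-1.
have t_ge0 : 0 <= t by rewrite invr_ge0 ler0n.
have t_le : t <= 1 / 2.
  by rewrite /t div1r lef_pV2 ?posrE ?ltr0n ?(ltnW p_gt1) // ler_nat.
have bern (y : rat) (m : nat) : 0 <= y -> 1 + y * m%:R <= (1 + y) ^+ m.
  move=> y0; elim: m => [|m IH]; first by rewrite mulr0 addr0 expr0.
  rewrite exprS; have : 0 <= m%:R :> rat by rewrite ler0n.
  by rewrite -natr1; nra.
have y_ge0 : 0 <= 1 / 14 * t by lra.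
have := bern _ 28 y_ge0; move: (_ ^+ 28) => Z hZ.
have := ler_wpM2l (_ : 0 <= 1 - t) hZ; have := mulr_ge0 t_ge0 (_ : 0 <= 1 - 2 * t).
by move=> /(_ ltac:(lra)) ? /(_ ltac:(lra)) ?; lra.
Qed.

(** Factor by factor, with [t = 1/p]: the linear coefficient on the left is [6/7 + 1/14 = 13/14],
    and the spare [t/14] absorbs the quadratic and cubic terms once [t <= 1/5]. *)
Lemma prod_weight_sqr_le (P : seq nat) : all (leq 5) P ->
  (\prod_(p <- P) (1 + 3 / 7 / p%:R)) ^+ 2 * \prod_(p <- P) (1 + 1 / 14 / p%:R)
    <= \prod_(p <- P) (1 + p%:R^-1) :> rat.
Proof.
move=> P_ge5; rewrite -prodrXl -big_split big_seq [leRHS]big_seq /=.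
apply: ler_prod => p pP; have p_ge5 := allP P_ge5 p pP.
set t : rat := p%:R^-1.
have t_ge0 : 0 <= t by rewrite invr_ge0 ler0n.
have t_le : t <= 1 / 5.
  by rewrite /t div1r lef_pV2 ?posrE ?ltr0n ?ler_nat // (leq_trans _ p_ge5).
have t2_ge0 := mulr_ge0 t_ge0 t_ge0.
have t3_ge0 := mulr_ge0 t_ge0 t2_ge0.
have d1 : 0 <= t * (1 / 5 - t) by rewrite mulr_ge0 // subr_ge0.
have d2 : 0 <= t * t * (1 / 5 - t) by rewrite mulr_ge0 // subr_ge0.
by apply/andP; split; rewrite expr2; lra.
Qed.

(** * Bounds for the discarded integers *)

(** Telescoping from [1/(j+1)^2 <= 1/j - 1/(j+1)]. *)
Lemma sum_inv_sqr_le (a b : nat) : (0 < a)%N ->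
  \sum_(a.+1 <= m < b) (m%:R ^+ 2)^-1 <= a%:R^-1 :> rat.
Proof.
move=> a_gt0.
have tele k : \sum_(a.+1 <= m < k + a.+1) (m%:R ^+ 2)^-1
    <= a%:R^-1 - (k + a)%N%:R^-1 :> rat.
  elim: k => [|k IH]; first by rewrite big_geq // subrr.
  rewrite addSn big_nat_recr ?leq_addl //=.
  rewrite addnS addSn.
  rewrite addnS in IH; move: IH; set j := (k + a)%N => IH.
  have j_gt0 : 0 < j%:R :> rat by rewrite ltr0n addn_gt0 a_gt0 orbT.
  apply: le_trans (lerD IH (lexx _)) _.
  suff : j.+1%:R ^- 2 <= j%:R^-1 - j.+1%:R^-1 :> rat.
    by move: (_ ^- 2) (j%:R^-1) (j.+1%:R^-1) (a%:R^-1) => u v w z; lra.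
  rewrite -natr1; set y : rat := j%:R in j_gt0 *.
  have -> : y^-1 - (y + 1)^-1 = (y * (y + 1))^-1 by field; lra.
  by rewrite lef_pV2 ?posrE ?mulr_gt0 ?exprn_gt0 //; nra.
case: (leqP b a.+1) => [le_b|lt_b]; first by rewrite big_geq // invr_ge0 ler0n.
have := tele (b - a.+1)%N; rewrite subnK 1?ltnW //.
have : 0 <= (b - a.+1 + a)%N%:R^-1 :> rat by rewrite invr_ge0 ler0n.
lra.
Qed.

Lemma sum_le_indicator (x : nat) (y : rat) : 0 <= y ->
  \sum_(1 <= n < x.+1) (n%:R <= y)%R%:R <= y.
Proof.
move=> y_ge0; elim: x => [|x IH]; first by rewrite big_geq.
rewrite big_nat_recr //=; case: (lerP x.+1%:R y) => [le_xy|_]; last first.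
  by rewrite addr0.
apply: le_trans le_xy; rewrite -natr1 lerD2r.
apply: (@le_trans _ _ (\sum_(1 <= n < x.+1) 1)).
  by apply: ler_sum => n _; case: (_ <= y).
by rewrite sumr_const_nat subn1.
Qed.

(** * Many divisors forced by practicality *)

Lemma s_practical_S_s_lt (n : nat) :
  s_practical n -> (S_s n < 2 ^ size (divisors n))%N.
Proof.
move=> n_prac; set k := size _.
pose f (m : k.-tuple bool) := (\sum_(d <- mask m (divisors n)) s d)%N.
have sub : {subset iota 0 (S_s n).+1 <= [seq f m | m : k.-tuple bool]}.
  move=> m; rewrite mem_iota add0n ltnS leq0n /= => le_m.
  have [D [/subseqP[b size_b ->] ->]] :
      exists D, subseq D (divisors n) /\ m = (\sum_(d <- D) s d)%N.
    (* The value 0, given by the empty set, is counted too; this makes the inequality strict. *)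
    case: m le_m => [|m] le_m; last exact: n_prac.
    by exists [::]; rewrite sub0seq big_nil.
  by apply/imageP; exists (Tuple (introT eqP size_b)).
have := uniq_leq_size (iota_uniq _ _) sub.
by rewrite size_iota size_image card_tuple card_bool.
Qed.

Lemma count_upto_sum (P : nat -> Prop) (x : nat) :
  (count_upto P x)%:R = \sum_(1 <= n < x.+1) (`[< P n >] : bool)%:R :> rat.
Proof.
rewrite /count_upto -sum1dep_card big_mkcond /=.
rewrite -(big_mkord xpredT (fun n => if (0 < n)%N && `[< P n >] then 1 else 0)%N).
rewrite big_nat_recl // add0n natr_sum [RHS]big_add1 /=.
by apply: eq_bigr => n _; case: asboolP.
Qed.

(** With [k] the number of divisors, the chain is [2^L <= x <= (e x)^2 < n^2 <= (S_s n)^4 <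
    2^(4k)]. *)
Lemma log_lt_size_divisors (n x L : nat) (e : rat) :
  (0 < x)%N -> 0 < e -> 1 <= e ^+ 2 * x%:R -> (2 ^ L <= x)%N ->
  s_practical n -> (n <= S_s n ^ 2)%N -> e * x%:R < n%:R ->
  (L < 4 * size (divisors n))%N.
Proof.
move=> x_gt0 e_gt0 e2x le_Lx n_prac le_nS lt_exn.
have lt_S := s_practical_S_s_lt n_prac.
have lt_xn : (x < n ^ 2)%N.
  rewrite -(ltr_nat rat) natrX.
  have x_pos : 0 < x%:R :> rat by rewrite ltr0n.
  apply: (@le_lt_trans _ _ ((e * x%:R) ^+ 2)).
    by rewrite exprMn [X in _ * X]expr2 mulrA ler_peMl // ltW.
  by rewrite ltr_pXn2r ?nnegrE ?mulr_ge0 ?ler0n ?ltW.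
rewrite -(ltn_exp2l _ _ (ltnSn 1)); apply: leq_ltn_trans le_Lx _.
apply: ltn_trans lt_xn _.
apply: leq_ltn_trans (_ : (S_s n ^ 4 < _)%N).
  by rewrite -[4%N]/(2 * 2)%N expnM leq_exp2r.
by rewrite mulnC expnM ltn_exp2r.
Qed.

(** * Markov bounds for the four exceptional classes *)

Lemma count_s_practical_le (P : seq nat) (e : rat) (x L : nat) :
  all prime P -> uniq P -> 0 < e ->
  \sum_(p <- P) p%:R ^- 2 <= e ->
  8 / e ^+ 2 * (\prod_(p <- P) (1 + 3 / 7 / p%:R)) ^+ 2
    <= \prod_(p <- P) (1 + p%:R^-1) ->
  (0 < L)%N -> (2 ^ L <= x)%N -> 1 <= e ^+ 2 * x%:R ->
  harmonic [::] (\prod_(p <- P) p * x) <= 2 * L%:R ->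
  (count_upto (fun n : nat => s_practical n /\ n <= (S_s n) ^ 2)%N x)%:R
    <= 4 * e * x%:R.
Proof.
move=> P_pr P_uniq e_gt0 sq_le AB L_gt0 le_Lx e2x H_le.
have x_gt0 : (0 < x)%N by apply: leq_trans le_Lx; rewrite expn_gt0.
set A : rat := \prod_(p <- P) (1 + 3 / 7 / p%:R) in AB.
set B : rat := \prod_(p <- P) (1 + p%:R^-1) in AB.
have A_gt0 : 0 < A.
  by apply: prodr_gt0 => p _; rewrite ltr_pwDl // mulr_ge0 // invr_ge0 ler0n.
have xr : 0 < x%:R :> rat by rewrite ltr0n.
have Lr : 0 < L%:R :> rat by rewrite ltr0n.
set K := A / e; have K_gt0 : 0 < K by rewrite divr_gt0.
rewrite count_upto_sum.
(* Each term of [F] is nonnegative and at least 1 on its class: [n] small, [n] divisible by some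
   [p ^ 2], weight at least [K], or weight times [ndiv] at least [L / (4 K)]. Each sums to at most
   [e * x]. *)
pose F (n : nat) : rat := (n%:R <= e * x%:R)%R%:R
  + \sum_(p <- P) (p ^ 2 %| n)%N%:R
  + weight P n / K + weight P n * (ndiv P n)%:R * (4 * K / L%:R).
apply: (@le_trans _ _ (\sum_(1 <= n < x.+1) F n)).
  rewrite big_nat_cond [leRHS]big_nat_cond; apply: ler_sum => n.
  rewrite andbT => /andP[n_gt0 le_nx].
  have w_ge1 := weight_ge1 P n.
  have w_gt0 : 0 < weight P n by apply: lt_le_trans w_ge1.
  have s_ge0 : 0 <= \sum_(p <- P) (p ^ 2 %| n)%N%:R :> rat.
    by apply: sumr_ge0 => p _; rewrite ler0n.
  have t3 : 0 <= weight P n / K by rewrite divr_ge0 ?ltW.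
  have t4 : 0 <= weight P n * (ndiv P n)%:R * (4 * K / L%:R).
    by rewrite !mulr_ge0 ?invr_ge0 ?ler0n // ltW.
  rewrite /F; case: asboolP => [[n_prac le_nS]|_]; last first.
    by rewrite !addr_ge0 // ler0n.
  case: (lerP n%:R (e * x%:R)) => [_|lt_exn]; first by rewrite /=; lra.
  case: (boolP (all (fun p => ~~ (p ^ 2 %| n)%N) P)) => [sqf|]; last first.
    move=> /allPn[p pP]; rewrite negbK => p2n.
    suff : 1 <= \sum_(p <- P) (p ^ 2 %| n)%N%:R :> rat.
      by move: (\sum_(p <- P) _) s_ge0 => sq * /=; lra.
    rewrite (big_rem p) //= p2n lerDl.
    by apply: sumr_ge0 => q _; rewrite ler0n.
  have := log_lt_size_divisors x_gt0 e_gt0 e2x le_Lx n_prac le_nS lt_exn.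
  rewrite -(ltr_nat rat) natrM => lt_L.
  have tau_le := size_divisors_le_weight P_pr n_gt0 sqf.
  case: (lerP K (weight P n)) => [leK|ltK].
    have : 1 <= weight P n / K by rewrite ler_pdivlMr // mul1r.
    by rewrite /=; lra.
  (* With [w < K] the weight and [t] the value of [ndiv], the number of divisors is at most [w^2 t],
     so [L < 4 w^2 t <= 4 K w t]. *)
  suff : 1 <= weight P n * (ndiv P n)%:R * (4 * K / L%:R) by rewrite /=; lra.
  rewrite mulrA ler_pdivlMr // mul1r.
  have : weight P n ^+ 2 * (ndiv P n)%:R <= weight P n * K * (ndiv P n)%:R.
    by rewrite ler_wpM2r ?ler0n // expr2 ler_wpM2l // ltW.
  by move: tau_le lt_L; set v := (ndiv P n)%:R; set w := weight P n; lra.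
rewrite /F !big_split /= -!mulr_suml.
have b1 := sum_le_indicator x (ltW (mulr_gt0 e_gt0 xr)).
have b2 : \sum_(1 <= n < x.+1) \sum_(p <- P) (p ^ 2 %| n)%N%:R <= e * x%:R.
  rewrite exchange_big /= mulrC; apply: le_trans (ler_wpM2l (ltW xr) sq_le).
  rewrite mulr_sumr; apply: ler_sum => p _.
  by rewrite -natrX; apply: sum_dvdn_le.
have b3 : (\sum_(1 <= n < x.+1) weight P n) / K <= e * x%:R.
  have : \sum_(1 <= n < x.+1) weight P n <= x%:R * A.
    have no1 : no_dvd P 1.
      apply/allP => p pP; rewrite dvdn1 neq_ltn prime_gt1 ?orbT //.
      exact: (allP P_pr).
    have := sum_weight_dvd_le x P_pr P_uniq no1; rewrite invr1 mulr1.
    by under [X in X <= _ -> _]eq_bigr do rewrite dvd1n mul1r.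
  rewrite ler_pdivrMr // /K => /le_trans; apply.
  by rewrite le_eqVlt; apply/orP/or_introl/eqP; field; lra.
have b4 : (\sum_(1 <= n < x.+1) weight P n * (ndiv P n)%:R) * (4 * K / L%:R)
    <= e * x%:R.
  have c_ge0 : 0 <= 4 * K / L%:R by rewrite !mulr_ge0 ?invr_ge0 // ltW.
  apply: le_trans (ler_wpM2r c_ge0 (sum_weight_ndiv_le x P_pr P_uniq)) _.
  rewrite -/A.
  have BH := le_trans (prod_mul_harmonic_le x P_pr P_uniq) H_le.
  rewrite -/B in BH.
  set h := harmonic P x in BH *.
  have h_ge0 : 0 <= h by apply: sumr_ge0 => i _; rewrite invr_ge0 ler0n.
  have AH : 8 / e ^+ 2 * A ^+ 2 * h <= 2 * L%:R.
    exact: le_trans (ler_wpM2r h_ge0 AB) BH.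
  (* The constant 8 is the 4 from [4 * K / L] times the 2 from [H_le], so the bound comes out as
     exactly [e * x]. *)
  have -> : x%:R * A * h * (4 * K / L%:R) =
      (8 / e ^+ 2 * A ^+ 2 * h) * (e * x%:R / (2 * L%:R)).
    by rewrite /K; field; rewrite !gt_eqF.
  rewrite mulrA ler_pdivrMr ?mulr_gt0 // mulrC ler_wpM2l // ltW //.
  exact: mulr_gt0.
lra.
Qed.

Local Close Scope ring_scope.

Theorem theorem6p9 :
  density_zero (fun n : nat => s_practical n /\ n <= (S_s n) ^ 2).
Proof.
Local Open Scope ring_scope.
(* One quarter of [eps] for each exceptional class. *)
move=> eps eps_gt0; set e := eps / 4.
have e_gt0 : 0 < e by rewrite divr_gt0.
have archi (y : rat) : y <= (Num.bound `|y|)%:R.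
  exact: le_trans (ler_norm _) (ltW (archi_boundP (normr_ge0 _))).
(* Primes above [a] are at least 5, and their inverse squares sum to at most [1/a <= e]. *)
pose a := (Num.bound `|e^-1| + 4)%N.
have a_gt0 : (0 < a)%N by rewrite addn_gt0 orbT.
have inv_a : a%:R^-1 <= e.
  rewrite -[e]invrK lef_pV2 ?posrE ?invr_gt0 ?ltr0n //.
  by apply: le_trans (archi _) _; rewrite ler_nat leq_addr.
have [b hb] := @prod_primes_unbounded a.+1 (8 / e ^+ 2)
  (divr_ge0 (ler0n _ 8) (sqr_ge0 e)).
set P := primes_in a.+1 b in hb.
have P_pr : all prime P by exact: all_prime_primes_in.
have P_uniq : uniq P by exact: uniq_primes_in.
have P_ge5 : all (leq 5) P.
  apply/allP => p; rewrite mem_filter mem_index_iota => /and3P[_ lt_ap _].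
  by apply: leq_trans lt_ap; rewrite ltnS leq_addl.
have sq_le : \sum_(p <- P) p%:R ^- 2 <= e.
  apply: le_trans inv_a; apply: le_trans (sum_inv_sqr_le b a_gt0).
  rewrite /P big_filter big_mkcond /=; apply: ler_sum => m _.
  by case: ifP => // _; rewrite invr_ge0 sqr_ge0.
have AB : 8 / e ^+ 2 * (\prod_(p <- P) (1 + 3 / 7 / p%:R)) ^+ 2
    <= \prod_(p <- P) (1 + p%:R^-1).
  apply: le_trans (prod_weight_sqr_le P_ge5); rewrite mulrC.
  by apply: ler_wpM2l => //; apply: sqr_ge0.
set Q := (\prod_(p <- P) p)%N.
(* The first bound gives [Q < L], hence [Q * x < 2 ^ (Q + L + 1)] with [Q + L + 1 <= 2 * L]; the
   second gives [1 <= e ^ 2 * x]. *)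
exists (maxn (2 ^ Q.+1) (Num.bound `|e ^- 2|)) => x.
rewrite geq_max => /andP[le_Qx le_ex].
have x_gt0 : (0 < x)%N by apply: leq_trans le_Qx; rewrite expn_gt0.
pose L := trunc_log 2 x.
have /andP[le_Lx lt_xL] := trunc_log_bounds (ltnSn 1) x_gt0.
have lt_QL : (Q < L)%N by apply: trunc_log_max.
have -> : eps = 4 * e by rewrite /e; field.
apply: (@count_s_practical_le P e x L) => //.
- exact: leq_ltn_trans lt_QL.
- rewrite -ler_pdivrMl ?exprn_gt0 // mulr1.
  by apply: le_trans (archi _) _; rewrite ler_nat.
- apply: le_trans (harmonic_le (_ : _ < 2 ^ (Q + L.+1))%N) _.
    by rewrite expnD ltn_mul // ltn_expl.
  by rewrite -natrM ler_nat; lia.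
Qed.
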